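(* Let $J$ be a Jordan algebra over a field $K$ and let $V$ be a $K$-vector space of dimension $r\geq 1$. The isomorphism classes of Jordan algebras $\tilde J$ over $K$ with centre $Z(\tilde J)= V$ of dimension $r$ (i.e. with $r$-dimensional centre, identified with $V$), with $\tilde J/V\cong J$, and without central component, are in bijective correspondence with the elements of $U_r(J)/\operatorname{Aut}(J)$.
   Context: A Jordan algebra over a field $K$ is a $K$-vector space $J$ with a symmetric bilinear product $\circ$ satisfying $x^2\circ(x\circ y)=x\circ(x^2\circ y)$ for all $x,y$, where $x^2=x\circ x$. Its centre is $Z(J)=\{x\in J: x\circ y=0\ \forall y\in J\}$. $J$ has a central component if $J=I_1\oplus I_2$ is a direct sum of two ideals with $I_2$ nonzero and contained in $Z(J)$. $Z^2(J,K)$ is the space of symmetric bilinear maps $\theta:J\times J\to K$ with $\theta(x^2,x\circ y)=\theta(x,x^2\circ y)$ for all $x,y\in J$. For a linear map $f:J\to K$ put $(\delta f)(x,y)=f(x\circ y)$; these maps form the subspace $\delta C^1(J,K)\subseteq Z^2(J,K)$, and $H^2(J,K)=Z^2(J,K)/\delta C^1(J,K)$. The radical of a cocycle $\theta$ is $\theta^\perp=\{x\in J:\theta(x,y)=0\ \forall y\in J\}$; the set $\theta^\perp\cap Z(J)$ depends only on the class of $\theta$ in $H^2(J,K)$. The group $\operatorname{Aut}(J)$ acts on $Z^2(J,K)$ by $(\phi\theta)(x,y)=\theta(\phi x,\phi y)$, inducing an action on $H^2(J,K)$ and on the set $G_r(H^2(J,K))$ of $r$-dimensional subspaces of $H^2(J,K)$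 by $\phi\langle\theta_1,\dots,\theta_r\rangle=\langle\phi\theta_1,\dots,\phi\theta_r\rangle$. Let $$U_r(J)=\{\langle\theta_1,\dots,\theta_r\rangle\in G_r(H^2(J,K)) : \theta_1^\perp\cap\cdots\cap\theta_r^\perp\cap Z(J)=0\},$$ a set stable under $\operatorname{Aut}(J)$, and let $U_r(J)/\operatorname{Aut}(J)$ be its set of orbits. *)

(* Defs.v *)
From HB Require Import structures.
From mathcomp Require Import all_boot all_order all_algebra.
From mathcomp Require Import boolp classical_sets functions.
Set Implicit Arguments.
Unset Strict Implicit.
Unset Printing Implicit Defensive.
Import GRing.Theory.
Local Open Scope ring_scope.
Local Open Scope quotient_scope.
Local Open Scope classical_set_scope.

Record subspace (K : fieldType) (V : lmodType K) := Subspace {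
  subspace_mem :> {pred V};
  subspace_closed : submod_closed subspace_mem
}.

HB.instance Definition _ (K : fieldType) (V : lmodType K) (S : subspace V) :=
  GRing.isSubmodClosed.Build K V (subspace_mem S) (subspace_closed S).

Notation quotient S := (Quotient.quot (subspace_mem S)).

(* [Quotient.quot] only carries a Z-module structure in the library. *)
Section QuotientSpace.
Variables (K : fieldType) (V : lmodType K) (S : subspace V).
Local Notation Q := (quotient S).

Lemma pi_quotP (x y : V) : \pi_Q x = \pi_Q y <-> x - y \in S.
Proof. by rewrite Quotient.idealrBE; split=> /eqP. Qed.

Definition quot_scale (a : K) (x : Q) : Q := \pi_Q (a *: repr x).

Lemma pi_scale a (x : V) : quot_scale a (\pi_Q x) = \pi_Q (a *: x).
Proof.
apply/pi_quotP; rewrite -scalerBr rpredZ //.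
by apply/pi_quotP; rewrite reprK.
Qed.

Lemma quot_scalerA a b x : quot_scale a (quot_scale b x) = quot_scale (a * b) x.
Proof. by rewrite -[x]reprK !pi_scale ?reprK scalerA. Qed.

Lemma quot_scale1r : left_id 1 quot_scale.
Proof. by move=> x; rewrite -[x]reprK pi_scale scale1r. Qed.

Lemma quot_scalerDr : right_distributive quot_scale +%R.
Proof.
by move=> a x y; rewrite -[x]reprK -[y]reprK -raddfD !pi_scale -raddfD scalerDr.
Qed.

Lemma quot_scalerDl x : {morph quot_scale^~ x : a b / a + b}.
Proof. by move=> a b /=; rewrite -[x]reprK !pi_scale -raddfD scalerDl. Qed.

HB.instance Definition _ := GRing.Zmodule_isLmodule.Build K Q
  quot_scalerA quot_scale1r quot_scalerDr quot_scalerDl.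

Lemma pi_quot_scalable : scalable \pi_Q.
Proof. by move=> a x; rewrite -pi_scale. Qed.

HB.instance Definition _ := GRing.isScalable.Build K V Q *:%R \pi_Q
  pi_quot_scalable.
End QuotientSpace.

HB.mixin Record Lmodule_isJordan (K : fieldType) J of GRing.Lmodule K J := {
  jmul : J -> J -> J;
  jmulC : commutative jmul;
  jmul_bilinear : bilinear_for *:%R *:%R jmul;
  jmul_jordan : forall x y,
    jmul (jmul x x) (jmul x y) = jmul x (jmul (jmul x x) y)
}.

#[short(type="jordanType")]
HB.structure Definition Jordan (K : fieldType) :=
  {J of GRing.Lmodule K J & Lmodule_isJordan K J}.

Notation "x *o y" := (jmul x y) (at level 40, left associativity) : ring_scope.

Section JordanTheory.
Variables (K : fieldType) (J : jordanType K).
Implicit Types x y z : J.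

Lemma jmulDl x y z : (x + y) *o z = x *o z + y *o z.
Proof. by have := jmul_bilinear.1 z 1 x y; rewrite /= !scale1r. Qed.

Lemma jmulDr x y z : z *o (x + y) = z *o x + z *o y.
Proof. by rewrite !(jmulC z) jmulDl. Qed.

Lemma jmul0r z : 0 *o z = 0.
Proof. by apply: (addrI (0 *o z)); rewrite -jmulDl !addr0. Qed.

Lemma jmulr0 z : z *o 0 = 0.
Proof. by rewrite jmulC jmul0r. Qed.

Lemma jmulZl a x z : (a *: x) *o z = a *: (x *o z).
Proof. by have := jmul_bilinear.1 z a x 0; rewrite !addr0 jmul0r addr0. Qed.

Lemma jmulZr a x z : z *o (a *: x) = a *: (z *o x).
Proof. by rewrite !(jmulC z) jmulZl. Qed.

Lemma jmulNl x z : (- x) *o z = - (x *o z).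
Proof. by rewrite -!scaleN1r jmulZl. Qed.

Lemma jmulBl x y z : (x - y) *o z = x *o z - y *o z.
Proof. by rewrite jmulDl jmulNl. Qed.
End JordanTheory.

Record jordanIdeal (K : fieldType) (J : jordanType K) := JordanIdeal {
  ideal_subspace :> subspace J;
  ideal_jmul : forall x y, x \in ideal_subspace -> x *o y \in ideal_subspace
}.

Section QuotientAlgebra.
Variables (K : fieldType) (J : jordanType K) (I : jordanIdeal J).
Local Notation Q := (quotient I).

Definition quot_jmul (x y : Q) : Q := \pi_Q (repr x *o repr y).

Lemma pi_jmul (x y : J) : quot_jmul (\pi_Q x) (\pi_Q y) = \pi_Q (x *o y).
Proof.
have E z : repr (\pi_Q z) - z \in I by apply/pi_quotP; rewrite reprK.
apply/pi_quotP; set x' := repr _; set y' := repr _.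
have -> : x' *o y' - x *o y = (x' - x) *o y' + (y' - y) *o x.
  by rewrite !jmulBl (jmulC y') (jmulC y) addrA subrK.
by rewrite rpredD // ideal_jmul // E.
Qed.

Lemma quot_jmulC : commutative quot_jmul.
Proof. by move=> x y; rewrite /quot_jmul jmulC. Qed.

Lemma quot_jmul_bilinear : bilinear_for *:%R *:%R quot_jmul.
Proof.
suff L z : linear (quot_jmul^~ z).
  by split=> // z a x y; rewrite !(quot_jmulC z) L.
move=> a x y /=; rewrite -[x]reprK -[y]reprK -[z]reprK -linearP.
by rewrite (pi_jmul (a *: _ + _)) !(pi_jmul (repr _)) jmulDl jmulZl linearP.
Qed.

Lemma quot_jordan x y :
  quot_jmul (quot_jmul x x) (quot_jmul x y) =
  quot_jmul x (quot_jmul (quot_jmul x x) y).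
Proof.
have E u v : quot_jmul (\pi_Q u) (\pi_Q v) = \pi_Q (u *o v) := pi_jmul u v.
rewrite -[x]reprK -[y]reprK; set u := repr x; set v := repr y.
by rewrite !(E u u) (E u v) !(E (u *o u)) E jmul_jordan.
Qed.

HB.instance Definition _ := Lmodule_isJordan.Build K Q
  quot_jmulC quot_jmul_bilinear quot_jordan.
End QuotientAlgebra.

Section Center.
Variables (K : fieldType) (J : jordanType K).

(* The annihilator of J, not the commutative-associative centre. *)
Definition center_mem : {pred J} := fun x => `[< forall y, x *o y = 0 >].

Lemma center_closed : submod_closed center_mem.
Proof.
split=> [|a x y /asboolP hx /asboolP hy]; apply/asboolP => z.
  by rewrite jmul0r.
by rewrite jmulDl jmulZl hx hy scaler0 addr0.
Qed.

Lemma center_jmul x y : x \in center_mem -> x *o y \in center_mem.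
Proof. by move=> /asboolP hx; apply/asboolP => z; rewrite hx jmul0r. Qed.

Definition center : jordanIdeal J :=
  @JordanIdeal K J (Subspace center_closed) center_jmul.
End Center.
Arguments center {K} J.

Definition has_central_component (K : fieldType) (J : jordanType K) : Prop :=
  exists I1 I2 : jordanIdeal J,
    [/\ forall x, exists x1 x2, [/\ x1 \in I1, x2 \in I2 & x = x1 + x2],
        forall x, x \in I1 -> x \in I2 -> x = 0,
        exists2 x, x \in I2 & x != 0
      & {subset I2 <= center J}].

Definition is_jordan_iso (K : fieldType) (A B : jordanType K)
    (f : {linear A -> B}) : Prop :=
  bijective f /\ {morph f : x y / x *o y}.

Definition jordan_isomorphic (K : fieldType) (A B : jordanType K) : Prop :=
  exists f : {linear A -> B}, is_jordan_iso f.

Record jordan_aut (K : fieldType) (J : jordanType K) := JordanAut {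
  aut_linear :> {linear J -> J};
  aut_iso : is_jordan_iso aut_linear
}.

Section Cohomology.
Variables (K : fieldType) (J : jordanType K).

Definition is_cocycle (theta : J -> J -> K^o) : Prop :=
  [/\ bilinear_for *:%R *:%R theta, commutative theta
    & forall x y, theta (x *o x) (x *o y) = theta x ((x *o x) *o y)].

Definition cocycle_mem : {pred J -> J -> K^o} := fun theta => `[< is_cocycle theta >].

Lemma cocycle_closed : submod_closed cocycle_mem.
Proof.
split=> [|a f g /asboolP[[fl fr] fC fJ] /asboolP[[gl gr] gC gJ]]; apply/asboolP.
  by split=> //; split=> x b y z /=; rewrite scaler0 addr0.
have E x y : (a *: f + g) x y = a *: f x y + g x y by [].
split=> [|x y|x y]; [split|by rewrite !E fC gC|by rewrite !E fJ gJ].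
  move=> u b x y /=; rewrite !E (fl u b x y) (gl u b x y).
  by rewrite !scalerDr !scalerA [a * b]mulrC addrACA.
move=> u b x y /=; rewrite !E (fr u b x y) (gr u b x y).
by rewrite !scalerDr !scalerA [a * b]mulrC addrACA.
Qed.

HB.instance Definition _ :=
  GRing.isSubmodClosed.Build K (J -> J -> K^o) cocycle_mem cocycle_closed.

Record cocycle := Cocycle {
  cocycle_fun :> J -> J -> K^o;
  cocycleP : cocycle_fun \in cocycle_mem
}.
HB.instance Definition _ := [isSub for cocycle_fun].
HB.instance Definition _ := [Choice of cocycle by <:].
HB.instance Definition _ := [SubChoice_isSubLmodule of cocycle by <:].

Lemma cocycle_is_cocycle (theta : cocycle) : is_cocycle theta.
Proof. exact/asboolP/cocycleP. Qed.

Definition coboundary_mem : {pred cocycle} := fun theta =>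
  `[< exists f : {linear J -> K^o}, forall x y, theta x y = f (x *o y) >].

Lemma coboundary_closed : submod_closed coboundary_mem.
Proof.
split=> [|a s t /asboolP[f fE] /asboolP[g gE]]; apply/asboolP.
  by exists \0.
exists (a \*: f \+ g) => x y /=.
by rewrite -fE -gE.
Qed.

Definition coboundary : subspace cocycle := Subspace coboundary_closed.

Definition H2 := (quotient coboundary).
HB.instance Definition _ := GRing.Lmodule.on H2.

Definition coh_class (theta : cocycle) : H2 := \pi_(quotient coboundary) theta.

Definition radical (theta : cocycle) : set J :=
  [set x | forall y, theta x y = 0].

Lemma cocycle_act_subproof (phi : jordan_aut J) (theta : cocycle) :
  (fun x y => theta (phi x) (phi y)) \in cocycle_mem.
Proof.
have [[l r] C E] := cocycle_is_cocycle theta; have [_ phiM] := aut_iso phi.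
apply/asboolP; split=> [|x y|x y]; last 2 first.
- exact: C.
- by rewrite !phiM E.
split=> u a x y /=; rewrite linearP; [exact: l|exact: r].
Qed.

Definition cocycle_act (phi : jordan_aut J) (theta : cocycle) : cocycle :=
  Cocycle (cocycle_act_subproof phi theta).

Definition H2_act (phi : jordan_aut J) (c : H2) : H2 :=
  coh_class (cocycle_act phi (repr c)).

Lemma H2_act_class phi theta :
  H2_act phi (coh_class theta) = coh_class (cocycle_act phi theta).
Proof.
apply/pi_quotP/asboolP; set theta' := repr _.
have /pi_quotP/asboolP[f fE] :
  \pi_(quotient coboundary) theta' = \pi_(quotient coboundary) theta by rewrite reprK.
exists (f \o phi) => x y /=; have [_ phiM] := aut_iso phi.
by rewrite phiM -fE.
Qed.

Lemma H2_act_linear phi : linear (H2_act phi).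
Proof.
move=> a c d; rewrite -[c]reprK -[d]reprK -/(coh_class _) -linearP.
rewrite -[\pi_ _ _]/(coh_class _) !H2_act_class -linearP.
by congr (\pi_ _ _); apply/val_inj.
Qed.
HB.instance Definition _ phi := GRing.isLinear.Build K H2 H2 *:%R
  (H2_act phi) (H2_act_linear phi).
End Cohomology.

Definition lin_indep (K : fieldType) (V : lmodType K) r (v : 'I_r -> V) : Prop :=
  forall a : 'I_r -> K, \sum_i a i *: v i = 0 -> forall i, a i = 0.

Definition lin_span (K : fieldType) (V : lmodType K) r (v : 'I_r -> V) : set V :=
  [set w | exists a : 'I_r -> K, w = \sum_i a i *: v i].

Section Orbits.
Variables (K : fieldType) (J : jordanType K).

(* The last condition does not depend on the representatives [theta i]: two
   cohomologous cocycles take the same values on center J x J. *)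
Definition U r : set (set (H2 J)) :=
  [set W | exists theta : 'I_r -> cocycle J,
    [/\ lin_indep (fun i => coh_class (theta i)),
        W = lin_span (fun i => coh_class (theta i))
      & (\bigcap_i radical (theta i)) `&` [set` center J] = [set 0]]].

Definition aut_orbit (W : set (H2 J)) : set (set (H2 J)) :=
  [set W' | exists phi : jordan_aut J, W' = H2_act phi @` W].

Lemma H2_act_span (phi : jordan_aut J) r (theta : 'I_r -> cocycle J) :
  H2_act phi @` lin_span (fun i => coh_class (theta i)) =
  lin_span (fun i => coh_class (cocycle_act phi (theta i))).
Proof.
have E a : H2_act phi (\sum_i a i *: coh_class (theta i)) =
    \sum_i a i *: coh_class (cocycle_act phi (theta i)).
  rewrite linear_sum; apply: eq_bigr => i _.
  by rewrite linearZ /= H2_act_class.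
apply/seteqP; split=> [_ [_ [a ->] <-]|_ [a ->]]; first by exists a; exact: E.
by exists (\sum_i a i *: coh_class (theta i)) => //; exists a.
Qed.

(* The quotient U_r(J)/Aut(J). *)
Definition U_orbit r :=
  {O : set (set (H2 J)) | exists2 W, U r W & O = aut_orbit W}.
End Orbits.

(* [iota] identifies V with the centre of A, so the second clause reads A/V = J
   up to isomorphism. *)
Definition central_ext (K : fieldType) (J : jordanType K) (V : vectType K)
    (A : jordanType K) : Prop :=
  [/\ exists iota : {linear V -> A},
        injective iota /\ range iota = [set` center A],
      jordan_isomorphic (quotient (center A)) J
    & ~ has_central_component A].

(* The set of isomorphism classes: a class is the predicate of membership in it.
   [jordanType K] lies in too large a universe for [set (jordanType K)]. *)
Definition ext_class (K : fieldType) (J : jordanType K) (V : vectType K) :=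
  {C : jordanType K -> Prop |
    exists2 A, central_ext J V A & C = jordan_isomorphic A}.

(* Main.v *)
(** Each cocycle tuple theta : J x J -> K^r gives a Jordan product
    (x, u) o (y, v) = (x o y, theta(x, y)) on J * K^r.  Its centre is exactly
    0 * K^r when the common radical of theta meets Z(J) trivially.  An algebra
    has a central component if and only if some linear functional kills all
    products but not the centre; on J * K^r such functionals are the linear
    relations between the classes of the theta_i, so their independence means
    that there is no central component.  Conversely, a linear retraction of A
    onto its centre (which exists by Zorn's lemma, J being arbitrary) presents A
    as such an extension.  Finally, an isomorphism of extensions is an
    automorphism phi of J together with an invertible matrix M and a linear map f
    such that phi theta' = M theta + delta f, that is, an automorphism matching
    the spans of the classes. *)
Require Import Defs.
From HB Require Import structures.
From mathcomp Require Import all_boot all_order all_algebra.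
From mathcomp Require Import boolp classical_sets functions.
Import GRing.Theory.

Set Implicit Arguments.
Unset Strict Implicit.
Unset Printing Implicit Defensive.
Local Open Scope ring_scope.
Local Open Scope quotient_scope.
Local Open Scope classical_set_scope.

(** * Linear algebra in arbitrary dimension *)

Section LinearMaps.
Variable K : fieldType.
Implicit Types A B : lmodType K.

Lemma linear_fun_exists A B (f : A -> B) :
  linear f -> exists g : {linear A -> B}, g =1 f.
Proof.
move=> fl; pose m := GRing.isLinear.Build K A B *:%R f fl.
by exists (HB.pack_for {linear A -> B} f m).
Qed.

(** Zorn's lemma gives a maximal [C] among the sets closed under [k *: x + y] that meet the image of
    [i] at most in 0. Each [b] is then congruent modulo [C] to exactly one [i u], and [b |-> u] is
    the retraction. *)
Lemma injective_left_inverse A B (i : {linear A -> B}) :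
  injective i -> exists q : {linear B -> A}, cancel i q.
Proof.
move=> inj_i.
pose P (X : set B) := (forall k x y, X x -> X y -> X (k *: x + y)) /\
  forall u, X (i u) -> u = 0.
have [F FP Ftot|C [[Clin Ci] Cmax]] := @Zorn_bigcup B P.
  split=> [k x y [X FX Xx] [Y FY Yy]|u [X /FP[_]]]; last exact.
  have [XY|YX] := Ftot X Y FX FY.
    by exists Y => //; apply: (FP _ FY).1 => //; apply: XY.
  by exists X => //; apply: (FP _ FX).1 => //; apply: YX.
(* The empty set satisfies [P], so that [C] contains 0 has to come from maximality. *)
have C0 : C 0.
  apply: contrapT => C0; apply: (Cmax [set 0]).
    split=> [|/(_ 0 erefl)//] x Cx; case: C0.
    by have := Clin (-1) x x Cx Cx; rewrite scaleN1r addNr.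
  split=> [k x y -> ->|u /= iu0]; first by rewrite scaler0 addr0.
  by apply: inj_i; rewrite iu0 linear0.
have CZ k x : C x -> C (k *: x) by move=> Cx; rewrite -[_ *: _]addr0; apply: Clin.
have dec b : exists u, C (b - i u).
  apply: contrapT => nb.
  (* [D] is [C + K b]. If it met the image of [i] in some [i u] with [u != 0], then [b] would be
     congruent to [i (k^-1 *: u)], against [nb]. *)
  pose D := [set c | exists k, C (c - k *: b)].
  apply: (Cmax D).
    split=> [c Cc|DC]; first by exists 0; rewrite scale0r subr0.
    apply: nb; exists 0; rewrite linear0 subr0; apply: DC.
    by exists 1; rewrite scale1r subrr.
  split=> [k x y [s Cs] [t Ct]|u [k Ck]].
    exists (k * s + t); rewrite scalerDl opprD addrACA -scalerA -scalerBr.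
    exact: Clin.
  have [k0|kN0] := eqVneq k 0; first by apply: Ci; move: Ck; rewrite k0 scale0r subr0.
  case: nb; exists (k^-1 *: u).
  have := CZ (- k^-1) _ Ck; rewrite scalerBr scalerA mulNr mulVf //.
  by rewrite scaleN1r opprK scaleNr addrC [i (_ *: _)]linearZ.
have [q qP] := choice dec.
have qE b u : C (b - i u) -> q b = u.
  move=> Cu; apply/eqP; rewrite -subr_eq0; apply/eqP/Ci.
  have -> : i (q b - u) = (-1) *: (b - i (q b)) + (b - i u).
    by rewrite linearB scaleN1r opprB addrA subrK.
  exact: Clin.
have [|g gE] := @linear_fun_exists B A q.
  move=> k x y; apply: qE; rewrite linearP opprD addrACA -scalerBr.
  exact: Clin.
by exists g => u; rewrite gE; apply: qE; rewrite subrr.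
Qed.

(** A row killed by [M] is a linear relation between the [w i]. *)
Lemma lin_indep_change A r (v w : 'I_r -> A) (M : 'M[K]_r) :
    lin_indep w -> (forall i, w i = \sum_j M i j *: v j) -> M \in unitmx.
Proof.
move=> w_free wE; rewrite -row_free_unit -kermx_eq0; apply/rowV0P => a /sub_kermxP aM.
apply/rowP => i; rewrite mxE; apply: (w_free (fun i => a 0 i)) => {i}.
under eq_bigr do rewrite wE scaler_sumr.
rewrite exchange_big big1 //= => j _.
under eq_bigr do rewrite scalerA.
have /rowP/(_ j) := aM; rewrite !mxE -scaler_suml => ->.
by rewrite scale0r.
Qed.

(** Both families have [r] members, so the transition matrix is square and its inverse expresses [v]
    through [w]. *)
Lemma lin_span_eq A r (v w : 'I_r -> A) :
  lin_indep w -> (forall i, lin_span v (w i)) -> lin_span w = lin_span v.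
Proof.
move=> w_free /choice[m mE].
pose M := \matrix_(i, j) m i j.
have wE i : w i = \sum_j M i j *: v j.
  by rewrite mE; apply: eq_bigr => j _; rewrite mxE.
have /mulVmx MK := lin_indep_change w_free wE.
have vE i : v i = \sum_j invmx M i j *: w j.
  under eq_bigr do rewrite wE scaler_sumr; rewrite exchange_big /=.
  under eq_bigr => j _.
    under eq_bigr do rewrite scalerA.
    have /matrixP/(_ i j) := MK; rewrite !mxE -scaler_suml => ->.
    over.
  rewrite (bigD1 i) //= eqxx scale1r big1 ?addr0 // => j ji.
  by rewrite eq_sym (negPf ji) scale0r.
have span_sub (x y : 'I_r -> A) (N : 'M[K]_r) :
    (forall i, x i = \sum_j N i j *: y j) -> lin_span x `<=` lin_span y.
  move=> xE _ [a ->]; exists (fun j => \sum_i a i * N i j).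
  under eq_bigr do rewrite xE scaler_sumr; rewrite exchange_big /=.
  apply: eq_bigr => j _; rewrite scaler_suml.
  by apply: eq_bigr => i _; rewrite scalerA.
by apply/seteqP; split; [exact: span_sub wE|exact: span_sub vE].
Qed.
End LinearMaps.

(** * Isomorphism classes and central components *)

Section JordanIso.
Variable K : fieldType.
Implicit Types A B C : jordanType K.

Lemma jordan_isomorphic_refl A : jordan_isomorphic A A.
Proof. by exists idfun; split=> //; exists idfun. Qed.

Lemma jordan_isomorphic_sym A B : jordan_isomorphic A B -> jordan_isomorphic B A.
Proof.
case=> f [[g fK gK] fM].
have [|h hE] := @linear_fun_exists K B A g.
  by move=> a x y; apply: (can_inj fK); rewrite gK linearP !gK.
exists h; split=> [|x y].
  by exists f => x; rewrite hE // fK.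
by rewrite !hE; apply: (can_inj fK); rewrite fM !gK.
Qed.

Lemma jordan_isomorphic_trans B A C :
  jordan_isomorphic A B -> jordan_isomorphic B C -> jordan_isomorphic A C.
Proof.
case=> f [f_bij fM] [g [g_bij gM]]; exists (g \o f : {linear A -> C}).
by split=> [|x y /=]; [exact: bij_comp|rewrite fM gM].
Qed.

Lemma jordan_isomorphic_class A B :
  jordan_isomorphic A = jordan_isomorphic B <-> jordan_isomorphic A B.
Proof.
split=> [->|AB]; first exact: jordan_isomorphic_refl.
apply: funext => C; apply: propext; split; last exact: jordan_isomorphic_trans.
exact/jordan_isomorphic_trans/jordan_isomorphic_sym.
Qed.

Lemma centerP A x : reflect (forall y, x *o y = 0) (x \in center A).
Proof. exact: asboolP. Qed.

(* A functional that kills [A *o A] but not the centre splits off the line of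
   any central element on which it does not vanish. *)
Lemma has_central_componentI A (l : {linear A -> K^o}) z :
    (forall x y, l (x *o y) = 0) -> z \in center A -> l z != 0 ->
  has_central_component A.
Proof.
move=> lM /centerP zZ lz.
(* The kernel of [l] is an ideal because it contains all products; the line of [z] is one because
   [z] annihilates [A]. *)
pose I1m : {pred A} := fun x => `[< l x = 0 >].
pose I2m : {pred A} := fun x => `[< exists k, x = k *: z >].
have I1c : submod_closed I1m.
  split=> [|a x y /asboolP lx /asboolP ly]; apply/asboolP; first exact: linear0.
  by rewrite linearP lx ly scaler0 addr0.
have I2c : submod_closed I2m.
  split=> [|a x y /asboolP[k ->] /asboolP[m ->]]; apply/asboolP.
    by exists 0; rewrite scale0r.
  by exists (a * k + m); rewrite scalerDl scalerA.
have I1i x y : x \in I1m -> x *o y \in I1m by move=> _; apply/asboolP.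
have I2i x y : x \in I2m -> x *o y \in I2m.
  move=> /asboolP[k ->]; apply/asboolP; exists 0.
  by rewrite jmulZl zZ scaler0 scale0r.
exists (@JordanIdeal K A (Subspace I1c) I1i), (@JordanIdeal K A (Subspace I2c) I2i).
split=> [x|x /asboolP lx /asboolP[k xE]||x /asboolP[k ->]].
- exists (x - (l x / l z) *: z), ((l x / l z) *: z); split; last by rewrite subrK.
    by apply/asboolP; rewrite linearB linearZ /= -[_ *: _]/(_ * _) divfK ?subrr.
  by apply/asboolP; exists (l x / l z).
- move/eqP: lx; rewrite xE linearZ /= mulf_eq0 (negPf lz) orbF => /eqP->.
  by rewrite scale0r.
- exists z; first by apply/asboolP; exists 1; rewrite scale1r.
  by apply: contra_neq lz => ->; rewrite linear0.
- by rewrite rpredZ //; apply/centerP.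
Qed.

End JordanIso.

(** * The algebra attached to a tuple of cocycles *)

Section Extension.
Variables (K : fieldType) (J : jordanType K) (r : nat).
Implicit Types theta : 'I_r -> cocycle J.

(** Removes the quotient: relations in [H2] become identities of bilinear maps up to a coboundary
    term. *)
Lemma coh_class_combP (t : cocycle J) theta (a : 'I_r -> K) :
  coh_class t = \sum_i a i *: coh_class (theta i) <->
  exists f : {linear J -> K^o},
    forall x y, t x y = f (x *o y) + \sum_i a i * theta i x y.
Proof.
have -> : \sum_i a i *: coh_class (theta i) = coh_class (\sum_i a i *: theta i).
  rewrite /coh_class linear_sum; apply: eq_bigr => i _.
  by rewrite linearZ.
have E x y : (\sum_i a i *: theta i : cocycle J) x y = \sum_i a i * theta i x y.
  elim/big_rec2: _ => // i c s _ <-; exact: erefl.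
have B (s u : cocycle J) x y : (s - u) x y = s x y - u x y by [].
rewrite pi_quotP; split=> [/asboolP[f fE]|[f fE]]; first exists f => x y.
  by rewrite -fE B E subrK.
apply/asboolP; exists f => x y.
by rewrite B E fE addrK.
Qed.

Lemma coh_class_lin_indepP theta :
  lin_indep (fun i => coh_class (theta i)) <->
  forall (a : 'I_r -> K) (f : {linear J -> K^o}),
    (forall x y, f (x *o y) = \sum_i a i * theta i x y) -> forall i, a i = 0.
Proof.
have E a : \sum_i a i *: coh_class (theta i) = 0 <->
    exists f : {linear J -> K^o}, forall x y, f (x *o y) = \sum_i a i * theta i x y.
  have c0 : coh_class (0 : cocycle J) = 0 by rewrite /coh_class linear0.
  split=> [sum0|[f fE]].
    have [f fE] := (coh_class_combP 0 theta a).1 (etrans c0 (esym sum0)).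
    exists (\- f) => x y /=; apply/eqP; rewrite eq_sym -addr_eq0 addrC.
    by rewrite -fE.
  apply: etrans (esym _) c0; apply/(coh_class_combP 0 theta a).2; exists (\- f) => x y /=.
  by rewrite fE addNr.
split=> [indep a f fE|indep a /E[f fE]]; last exact: indep fE.
by apply: indep; apply/E; exists f.
Qed.

(** The parameter is a tag that lets each tuple put its own Jordan product on the same vector
    space. *)
Definition extension theta : Type := (J * 'rV[K]_r)%type.

Section Algebra.
Variable theta : 'I_r -> cocycle J.
Local Notation E := (extension theta).
HB.instance Definition _ := GRing.Lmodule.on E.
Implicit Types a b c : E.

Definition ext_cocycle (x y : J) : 'rV[K]_r := \row_i theta i x y.

Definition ext_mul a b : E := (a.1 *o b.1, ext_cocycle a.1 b.1).

Lemma ext_cocycleP k x y z :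
  ext_cocycle (k *: x + y) z = k *: ext_cocycle x z + ext_cocycle y z.
Proof.
apply/rowP => i; rewrite !mxE; have [[l _] _ _] := cocycle_is_cocycle (theta i).
exact: l.
Qed.

Lemma ext_cocycleC : commutative ext_cocycle.
Proof.
move=> x y; apply/rowP => i; rewrite !mxE.
by have [_ + _] := cocycle_is_cocycle (theta i).
Qed.

Lemma ext_mulC : commutative ext_mul.
Proof. by move=> a b; rewrite /ext_mul jmulC ext_cocycleC. Qed.

Lemma ext_mul_bilinear : bilinear_for *:%R *:%R ext_mul.
Proof.
suff L c : linear (ext_mul^~ c).
  by split=> // c k a b; rewrite !(ext_mulC c) L.
by move=> k a b; congr pair; rewrite /= ?ext_cocycleP // jmulDl jmulZl.
Qed.

Lemma ext_mul_jordan a b :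
  ext_mul (ext_mul a a) (ext_mul a b) = ext_mul a (ext_mul (ext_mul a a) b).
Proof.
congr pair; rewrite /= ?jmul_jordan //; apply/rowP => i; rewrite !mxE.
by have [_ _] := cocycle_is_cocycle (theta i).
Qed.

HB.instance Definition _ := Lmodule_isJordan.Build K E
  ext_mulC ext_mul_bilinear ext_mul_jordan.
End Algebra.

Lemma ext_mulE theta (a b : extension theta) :
  a *o b = (a.1 *o b.1, \row_i theta i a.1 b.1).
Proof. by []. Qed.

(** The conditions defining [U], put on a tuple instead of its span. These tuples parametrise both
    sides of the bijection. *)
Definition admissible theta : Prop :=
  lin_indep (fun i => coh_class (theta i)) /\
  (\bigcap_i radical (theta i)) `&` [set` center J] = [set 0].

(** A pair [(x, u)] annihilates everything exactly when [x] is central in [J] and lies in every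
    radical, that is, when [x = 0]. *)
Lemma ext_centerP theta (adm : admissible theta) (a : extension theta) :
  reflect (a.1 = 0) (a \in center (extension theta)).
Proof.
have [_ rad] := adm; apply: (iffP (centerP _)) => [aZ|a0 b].
  suff : ((\bigcap_i radical (theta i)) `&` [set` center J]) a.1 by rewrite rad.
  split=> [i _ y|]; last first.
    by apply/centerP => y; have /(congr1 fst) := aZ ((y, 0) : extension theta).
  have /(congr1 snd)/rowP/(_ i) := aZ ((y, 0) : extension theta).
  by rewrite !mxE.
rewrite ext_mulE a0 jmul0r; congr pair; apply/rowP => i; rewrite !mxE.
suff : radical (theta i) 0 by apply.
have : [set 0] (0 : J) by [].
by rewrite -rad => -[/(_ i I)].
Qed.

(** Applied below to a functional that kills products and to a coordinate of an isomorphism. *)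
Lemma ext_linear_form theta (l : {linear extension theta -> K^o}) :
  exists (f : {linear J -> K^o}) (m : 'I_r -> K),
    forall a, l a = f a.1 + \sum_i m i * a.2 0 i.
Proof.
have [|f fE] := @linear_fun_exists K J K^o (fun x => l (x, 0)).
  move=> k x y; rewrite -linearP; congr (l _); congr pair.
  by rewrite /= scaler0 addr0.
exists f, (fun i => l (0, delta_mx 0 i)) => -[x u] /=; rewrite fE.
pose j : 'rV[K]_r -> extension theta := pair 0.
have [|g gE] := @linear_fun_exists K 'rV[K]_r K^o (fun u => l (j u)).
  move=> k v w; rewrite -linearP; congr (l _); congr pair.
  by rewrite /= scaler0 addr0.
have -> : ((x, u) : extension theta) = (x, 0) + j u by congr pair; rewrite /= ?addr0 ?add0r.
rewrite linearD -gE {1}[u]row_sum_delta linear_sum; congr (_ + _).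
by apply: eq_bigr => i _; rewrite linearZ gE /= -[_ *: _]/(_ * _) mulrC.
Qed.

(** The projection [q] onto [I2] along [I1] sends products to 0, since [I2] is central and [I1] is
    an ideal. A coordinate of [q] is thus a functional killing products; independence of the classes
    makes it vanish on the centre, yet it is nonzero at [z]. *)
Lemma ext_no_central_component theta :
  admissible theta -> ~ has_central_component (extension theta).
Proof.
move=> adm [I1 [I2 [sum12 cap12 [z z2 zN0] sub2]]].
have uniq12 a b c d : a \in I1 -> b \in I1 -> c \in I2 -> d \in I2 ->
    a + c = b + d -> c = d.
  move=> a1 b1 c2 d2 E; apply/eqP; rewrite -subr_eq0; apply/eqP/cap12.
    have -> : c - d = b - a; last exact: rpredB.
    by apply/eqP; rewrite subr_eq addrAC -E addrC addKr.
  exact: rpredB.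
have [p pP] := choice (fun x => sum12 x).
have {pP}[q qP] := choice pP.
have qE x y : x - y \in I1 -> y \in I2 -> q x = y.
  move=> xy1 y2; have [p1 q2 xE] := qP x.
  by apply: uniq12 p1 xy1 q2 y2 _; rewrite -xE subrK.
have [i zi] : exists i, z.2 0 i != 0.
  apply: contrapT => nz; case/eqP: zN0.
  have z10 := elimT (ext_centerP adm z) (sub2 _ z2).
  case: (z) z10 nz => x u /= -> nz; congr pair; apply/rowP => i; rewrite !mxE.
  by apply/eqP/negP => /negP ui; apply: nz; exists i.
have [|l lE] := @linear_fun_exists K (extension theta) K^o (fun a => (q a).2 0 i).
  move=> k a b; have [pa1 qa2 aE] := qP a; have [pb1 qb2 bE] := qP b.
  rewrite (qE _ (k *: q a + q b)) ?mxE //; last by rewrite rpredD // rpredZ.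
  rewrite opprD addrACA -scalerBr {1}aE {1}bE !addrK.
  by rewrite rpredD // rpredZ.
have lM a b : l (a *o b) = 0.
  rewrite lE (qE _ 0) ?mxE ?rpred0 // subr0.
  have [pa1 qa2 aE] := qP a.
  have /centerP qaZ := sub2 _ qa2.
  by rewrite aE jmulDl qaZ addr0 ideal_jmul.
have [f [m fE]] := ext_linear_form l.
(* Vanishing on products says that the combination of the [theta i] with coefficients [m] is the
   coboundary of [\- f]. *)
have m0 : forall i, m i = 0.
  apply: ((coh_class_lin_indepP theta).1 adm.1 m (\- f)) => x y.
  have := lM (x, 0) (y, 0); rewrite fE ext_mulE /= => /eqP.
  rewrite addrC addr_eq0 => /eqP <-.
  by apply: eq_bigr => j _; rewrite mxE.
have z10 := elimT (ext_centerP adm z) (sub2 _ z2).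
case/eqP: zi; have := fE z; rewrite lE z10 linear0 add0r big1 => [|j _].
  by rewrite (qE z z) ?subrr ?rpred0.
by rewrite m0 mul0r.
Qed.

End Extension.

(** The first isomorphism theorem for the centre; it replaces representatives by a surjection
    [p]. *)
Lemma quot_center_isoP (K : fieldType) (A J : jordanType K) :
  jordan_isomorphic (quotient (center A)) J <->
  exists p : {linear A -> J}, [/\ forall x, exists a, p a = x,
    {morph p : a b / a *o b} & forall a, p a = 0 <-> a \in center A].
Proof.
pose Q : jordanType K := quotient (center A).
have pi0 (a : A) : \pi_Q a = 0 <-> a \in center A.
  have -> : (0 : Q) = \pi_Q (0 : A) by rewrite linear0.
  by rewrite pi_quotP subr0.
have piM (a b : A) : (\pi_Q a : Q) *o \pi_Q b = \pi_Q (a *o b) := pi_jmul _ a b.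
split=> [[f [f_bij fM]]|[p [p_surj pM p0]]].
  exists (f \o \pi_Q : {linear A -> J}); split=> [x|a b|a] /=.
  - have [g fK gK] := f_bij; exists (repr (g x)).
    by rewrite reprK gK.
  - by rewrite -piM fM.
  - rewrite -pi0; split=> [fa0|->]; last exact: linear0.
    by apply: (bij_inj f_bij); rewrite fa0 linear0.
have pi_p a : p (repr (\pi_Q a)) = p a.
  apply/eqP; rewrite -subr_eq0 -linearB; apply/eqP/p0/pi_quotP.
  exact: reprK.
have [|f fE] := @linear_fun_exists K Q J (fun x => p (repr x)).
  by move=> k x y; rewrite -[x in LHS]reprK -[y in LHS]reprK -linearP pi_p linearP.
exists f; split=> [|x y].
  have [s sK] := choice p_surj; exists (fun x => \pi_Q (s x)) => x.
    rewrite fE; set a := repr x; rewrite -[x]reprK -/a.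
    by apply/pi_quotP/p0; rewrite linearB sK subrr.
  by rewrite fE pi_p.
by rewrite !fE -[x in LHS]reprK -[y in LHS]reprK piM pi_p pM.
Qed.

Lemma vect_coordinates (K : fieldType) (V : vectType K) r : \dim {:V} = r ->
  exists e : {linear V -> 'rV[K]_r}, bijective e.
Proof.
move=> <-; pose b := vbasis {:V}.
have [e eE] := linear_fun_exists (passmx.rVof_linear b).
exists e; exists (passmx.vecof b) => v; rewrite eE.
  exact/passmx.rVofK/vbasisP.
exact/passmx.vecofK/vbasisP.
Qed.

(** * Passing between admissible tuples and algebras with given centre *)

Section Classification.
Variables (K : fieldType) (J : jordanType K) (r : nat).
Implicit Types theta : 'I_r -> cocycle J.

Lemma ext_central_ext (V : vectType K) theta :
  \dim {:V} = r -> admissible theta -> central_ext J V (extension theta).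
Proof.
move=> dimV adm; split; last exact: ext_no_central_component.
  have [e e_bij] := vect_coordinates dimV.
  have [|iota iotaE] := @linear_fun_exists K V (extension theta) (fun v => (0, e v)).
    by move=> k u v; congr pair; rewrite /= ?linearP // scaler0 addr0.
  exists iota; split=> [u v|].
    by rewrite !iotaE => -[/(bij_inj e_bij)].
  apply/seteqP; split=> [_ [v _ <-]|[x u] /(ext_centerP adm) /= ->].
    by apply/(ext_centerP adm); rewrite iotaE.
  have [e' eK e'K] := e_bij.
  by exists (e' u) => //; rewrite iotaE e'K.
apply/quot_center_isoP.
have [|p pE] := @linear_fun_exists K (extension theta) J fst; first by [].

exists p; split=> [x|a b|a]; rewrite ?pE //.
  by exists (x, 0); rewrite pE.
by split=> [a0|/(ext_centerP adm) //]; apply/(ext_centerP adm).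
Qed.

(** With [q] a retraction onto the centre in coordinates and [s] a section of [p], the cocycles are
    the coordinates of [q (s x *o s y)], and [a |-> (p a, q a)] is the isomorphism. *)
Lemma central_ext_extension (V : vectType K) (A : jordanType K) :
    \dim {:V} = r -> central_ext J V A ->
  exists2 theta : 'I_r -> cocycle J,
    admissible theta & jordan_isomorphic A (extension theta).
Proof.
move=> dimV [[iota [iota_inj iotaZ]] /quot_center_isoP[p [p_surj pM p0]] ncc].
have {iota iota_inj iotaZ} [i [i_inj iZ]] : exists i : {linear 'rV[K]_r -> A},
    injective i /\ forall a, a \in center A <-> exists u, i u = a.
  have [e [e' eK e'K]] := vect_coordinates dimV.
  have [|i iE] := @linear_fun_exists K 'rV[K]_r A (fun u => iota (e' u)).
    move=> k u v; rewrite -linearP; congr (iota _).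
    by apply: (can_inj eK); rewrite linearP !e'K.
  exists i; split=> [u v|a]; first by rewrite !iE => /iota_inj/(can_inj e'K).
  split=> [aZ|[u <-]].
    have : [set` center A] a by [].
    by rewrite -iotaZ => -[v _ <-]; exists (e v); rewrite iE eK.
  by rewrite iE -/([set` center A] _) -iotaZ; exists (e' u).
have pi0 u : p (i u) = 0 by apply/p0/iZ; exists u.
have [q qK] := injective_left_inverse i_inj.
have pq_inj a b : p a = p b -> q a = q b -> a = b.
  move=> pab qab; apply/eqP; rewrite -subr_eq0; apply/eqP.
  have /p0/iZ[u uE] : p (a - b) = 0 by rewrite linearB pab subrr.
  by rewrite -uE -[u]qK uE linearB qab subrr linear0.
have [s sK] := choice p_surj.
(* The section [s] is only set-theoretic. This is harmless: a product depends on its factors modulo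
   the centre, so any lifts may replace [s x] and [s y]. *)
have mulE a b a' b' : p a = p a' -> p b = p b' -> a *o b = a' *o b'.
  move=> aE bE.
  have /p0/centerP aZ : p (a - a') = 0 by rewrite linearB aE subrr.
  have /p0/centerP bZ : p (b - b') = 0 by rewrite linearB bE subrr.
  have /eqP := aZ b; rewrite jmulBl subr_eq0 => /eqP ->.
  by have /eqP := bZ a'; rewrite jmulBl subr_eq0 !(jmulC _ a') => /eqP.
have qs x y a b : p a = x -> p b = y -> q (s x *o s y) = q (a *o b).
  by move=> <- <-; congr (q _); apply: mulE; rewrite sK.
have th_cocycle j : (fun x y => q (s x *o s y) 0 j : K^o) \in @cocycle_mem K J.
  apply/asboolP; split=> [|x y|x y]; last 2 first.
  - by rewrite jmulC.
  - have ps a b : p (s a *o s b) = a *o b by rewrite pM !sK.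
    rewrite (qs _ _ _ _ (ps x x) (ps x y)) (qs x _ (s x) (s x *o s x *o s y)) ?sK //.
      by rewrite jmul_jordan.
    by rewrite pM ps sK.
  suff L y : linear (fun x => q (s x *o s y) 0 j : K^o).
    by split=> y k u v /=; [exact: L|rewrite !(jmulC (s y)); exact: L].
  move=> k u v; rewrite (qs _ _ (k *: s u + s v) (s y)) ?sK ?linearP ?sK //.
  by rewrite jmulDl jmulZl linearP !mxE.
pose theta j := Cocycle (th_cocycle j).
have pqE a b j : q (a *o b) 0 j = theta j (p a) (p b).
  by rewrite /= (qs _ _ a b).
exists theta; last first.
  have [|f fE] := @linear_fun_exists K A (extension theta) (fun a => (p a, q a)).
    by move=> k a b; congr pair; rewrite /= linearP.
  exists f; split=> [|a b]; last first.
    rewrite !fE ext_mulE pM; congr pair; apply/rowP => j; rewrite mxE.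
    exact: pqE.
  (* Lift [x], then correct the central coordinate of the lift to [u]. *)
  exists (fun c => s c.1 + i (c.2 - q (s c.1))) => [a|[x u]].
    rewrite fE /=; apply: pq_inj; first by rewrite linearD pi0 sK addr0.
    by rewrite linearD qK addrC subrK.
  by rewrite fE; congr pair; rewrite linearD ?pi0 ?sK ?addr0 // qK addrC subrK.
split; last first.
  apply/seteqP; split=> [x [xrad /centerP xZ]|x ->]; last first.
    split; last by apply: rpred0.
    by move=> j _ y; have := pqE 0 (s y) j; rewrite jmul0r !linear0 sK mxE => <-.
  (* Products with [s x] vanish under both [p] and [q], so [s x] is central and
     [x = p (s x) = 0]. *)
  have sxZ : s x \in center A.
    apply/centerP => a; apply: pq_inj; first by rewrite pM sK xZ linear0.
    by apply/rowP => j; rewrite pqE sK (xrad j I) linear0 mxE.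
  by move/p0: sxZ; rewrite sK.
apply/coh_class_lin_indepP => a f fE j; apply: contrapT => aj; apply: ncc.
(* A relation with [a j != 0] yields a functional that kills products and takes the value [a j] at
   the [j]-th basis vector of the centre, hence a central component. *)
have [|l lE] := @linear_fun_exists K A K^o (fun b => \sum_i a i * q b 0 i - f (p b)).
  move=> k b c; rewrite !linearP scalerDr addrACA; congr (_ + _).
  rewrite scaler_sumr -big_split; apply: eq_bigr => m _ /=.
  by rewrite !mxE mulrDr mulrCA.
apply: (@has_central_componentI _ _ l (i (delta_mx 0 j))).
- move=> b c; rewrite lE pM fE; apply/eqP; rewrite subr_eq0; apply/eqP.
  by apply: eq_bigr => m _; rewrite pqE.
- by apply/iZ; exists (delta_mx 0 j).
- rewrite lE pi0 linear0 subr0 qK (bigD1 j) //= mxE !eqxx mulr1 big1 ?addr0.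
    exact/eqP.
  by move=> m mj; rewrite mxE (negPf mj) andbF mulr0.
Qed.

(** * Isomorphisms between extensions *)

Lemma cocycle_act_lin_indep (phi : jordan_aut J) theta :
  lin_indep (fun i => coh_class (theta i)) ->
  lin_indep (fun i => coh_class (cocycle_act phi (theta i))).
Proof.
have [[psi phiK psiK] phiM] := aut_iso phi.
move/coh_class_lin_indepP => indep; apply/coh_class_lin_indepP => a f fE.
have [|g gE] := @linear_fun_exists K J J psi.
  by move=> k x y; apply: (can_inj phiK); rewrite psiK linearP !psiK.
apply: (indep a (f \o g)) => x y /=.
have -> : g (x *o y) = g x *o g y.
  by apply: (can_inj phiK); rewrite phiM !gE !psiK.
by rewrite fE; apply: eq_bigr => i _ /=; rewrite !gE !psiK.
Qed.

(* If [theta' = M theta + delta f] then [(x, u) |-> (x, M u + f x)] is an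
   isomorphism. *)
Lemma extension_iso_span theta theta' :
    lin_indep (fun i => coh_class (theta' i)) ->
    (forall i, lin_span (fun j => coh_class (theta j)) (coh_class (theta' i))) ->
  jordan_isomorphic (extension theta) (extension theta').
Proof.
move=> indep' /choice[m mE].
pose M := \matrix_(i, j) m i j.
have Munit : M \in unitmx.
  apply: (lin_indep_change indep') => i; rewrite mE.
  by apply: eq_bigr => j _; rewrite mxE.
have /choice[f fE] i := (coh_class_combP (theta' i) theta (m i)).1 (mE i).
pose F x : 'rV[K]_r := \row_i f i x.
(* Central coordinates are row vectors, so [M] acts as [M^T] on the right. *)
have [|g gE] := @linear_fun_exists K (extension theta) (extension theta')
    (fun a => (a.1, a.2 *m M^T + F a.1)).
  move=> k a b; congr pair; rewrite /= mulmxDl -scalemxAl scalerDr addrACA.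
  congr (_ + _); apply/rowP => i; rewrite !mxE; exact: linearP.
exists g; split=> [|a b]; last first.
  rewrite !gE !ext_mulE; congr pair; apply/rowP => i; rewrite !mxE fE addrC.
  by congr (_ + _); apply: eq_bigr => j _; rewrite !mxE mulrC.
have MTunit : M^T \in unitmx by rewrite unitmx_tr.
exists (fun a => (a.1, (a.2 - F a.1) *m invmx M^T)) => -[x u].
  by rewrite gE /= addrK mulmxK.
by rewrite gE /= mulmxKV // subrK.
Qed.

Lemma extension_iso_act (phi : jordan_aut J) theta :
  jordan_isomorphic (extension (fun i => cocycle_act phi (theta i))) (extension theta).
Proof.
have [[psi phiK psiK] phiM] := aut_iso phi.
have [|g gE] := @linear_fun_exists K
    (extension (fun i => cocycle_act phi (theta i))) (extension theta)
    (fun a => (phi a.1, a.2)).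
  by move=> k a b; congr pair; rewrite /= linearP.
exists g; split=> [|a b]; last by rewrite !gE !ext_mulE /= phiM.
by exists (fun a => (psi a.1, a.2)) => -[x u]; rewrite gE /= ?phiK ?psiK.
Qed.

(* An isomorphism preserves centres, hence induces an automorphism [phi] of [J];
   its components along the centre express [phi theta'] through [theta]. *)
Lemma extension_iso_orbit theta theta' :
    admissible theta -> admissible theta' ->
    jordan_isomorphic (extension theta) (extension theta') ->
  exists phi : jordan_aut J,
    lin_span (fun i => coh_class (cocycle_act phi (theta' i))) =
    lin_span (fun i => coh_class (theta i)).
Proof.
move=> adm adm' [g [[h gK hK] gM]].
have gZ a : (g a).1 = 0 <-> a.1 = 0.
  split=> [/(ext_centerP adm')/centerP ga0|/(ext_centerP adm)/centerP a0].
    apply/(ext_centerP adm)/centerP => b; apply: (can_inj gK).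
    by rewrite gM ga0 linear0.
  apply/(ext_centerP adm')/centerP => b; rewrite -[b]hK -gM a0.
  exact: linear0.
(* This makes the map induced on [J] independent of the chosen lift. *)
have g1E (a b : extension theta) : a.1 = b.1 -> (g a).1 = (g b).1.
  move=> ab; apply/eqP; rewrite -subr_eq0 -[_ - _]/((g a - g b).1) -linearB.
  by apply/eqP/gZ => /=; rewrite ab subrr.
pose s x : extension theta := (x, 0).
have [|phi phiE] := @linear_fun_exists K J J (fun x => (g (s x)).1).
  move=> k x y; rewrite -[RHS]/((k *: g (s x) + g (s y)).1) -linearP.
  exact: g1E.
have phi_g (a : extension theta) : phi a.1 = (g a).1 by rewrite phiE; apply: g1E.
have phi_iso : is_jordan_iso phi.
  split=> [|x y]; last first.
    have /= -> := phi_g (s x *o s y).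
    by rewrite gM !phiE.
  exists (fun x => (h (x, 0)).1) => x; last by rewrite phi_g hK.
  apply/eqP; rewrite -subr_eq0; apply/eqP.
  have /= <- := gZ (h (phi x, 0) - s x).
  by rewrite linearB hK /= -phiE subrr.
exists (JordanAut phi_iso); apply: lin_span_eq.
  exact: cocycle_act_lin_indep adm'.1.
move=> i.
(* Evaluated at a product of lifts of [x] and [y], this coordinate is [theta' i (phi x) (phi y)];
   splitting it along the two factors gives the coboundary [f] and the coefficients [m]. *)
have [|l lE] := @linear_fun_exists K (extension theta) K^o (fun a => (g a).2 0 i).
  by move=> k a b; rewrite linearP !mxE.
have [f [m fE]] := ext_linear_form l.
exists m; apply/coh_class_combP; exists f => x y /=.
have := fE (s x *o s y); rewrite lE gM ext_mulE /= mxE -!phiE => ->.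
by congr (_ + _); apply: eq_bigr => j _; rewrite mxE.
Qed.

(** * Orbits of the automorphism group *)

Lemma H2_act_id : exists e : jordan_aut J, forall c, H2_act e c = c.
Proof.
have id_iso : is_jordan_iso (idfun : {linear J -> J}) by split=> //; exists idfun.
exists (JordanAut id_iso) => c; rewrite -[c]reprK -/(coh_class _) H2_act_class.
by congr coh_class; apply: val_inj.
Qed.

(** Pulling back reverses composition, hence the witness [psi \o phi]. *)
Lemma H2_act_comp (phi psi : jordan_aut J) :
  exists om : jordan_aut J, forall c, H2_act om c = H2_act phi (H2_act psi c).
Proof.
have om_iso : is_jordan_iso (psi \o phi : {linear J -> J}).
  have [phi_bij phiM] := aut_iso phi; have [psi_bij psiM] := aut_iso psi.
  by split=> [|x y /=]; [exact: bij_comp|rewrite phiM psiM].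
exists (JordanAut om_iso) => c; rewrite -[c]reprK -/(coh_class _) !H2_act_class.
by congr coh_class; apply: val_inj.
Qed.

Lemma H2_act_inv (phi : jordan_aut J) :
  exists psi : jordan_aut J, cancel (H2_act phi) (H2_act psi).
Proof.
have [[g phiK gK] phiM] := aut_iso phi.
have [|psi psiE] := @linear_fun_exists K J J g.
  by move=> k x y; apply: (can_inj phiK); rewrite gK linearP !gK.
have psi_iso : is_jordan_iso psi.
  split=> [|x y]; last by apply: (can_inj phiK); rewrite phiM !psiE !gK.
  by exists phi => x; rewrite psiE.
exists (JordanAut psi_iso) => c; rewrite -[c]reprK -/(coh_class _) !H2_act_class.
congr coh_class; apply: val_inj; apply/funext => x; apply/funext => y /=.
by rewrite !psiE !gK.
Qed.

Lemma aut_orbit_eqP (W W' : set (H2 J)) :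
  aut_orbit W = aut_orbit W' <-> exists phi, W = H2_act phi @` W'.
Proof.
split=> [OW|[phi ->]].
  have [e eE] := H2_act_id; suff : aut_orbit W W by rewrite OW.
  by exists e; rewrite (_ : H2_act e = id) ?image_id //; apply/funext.
have [psi psiK] := H2_act_inv phi.
apply/seteqP; split=> [_ [chi ->]|_ [chi ->]].
  have [om omE] := H2_act_comp chi phi; exists om.
  by rewrite image_comp; apply: eq_imagel => c _; rewrite omE.
have [om omE] := H2_act_comp chi psi; exists om.
by rewrite image_comp; apply: eq_imagel => c _; rewrite /= omE psiK.
Qed.

Lemma extension_isoP theta theta' : admissible theta -> admissible theta' ->
  jordan_isomorphic (extension theta) (extension theta') <->
  aut_orbit (lin_span (fun i => coh_class (theta i))) =
  aut_orbit (lin_span (fun i => coh_class (theta' i))).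
Proof.
move=> adm adm'; rewrite aut_orbit_eqP; split=> [|[phi]].
  by move/(extension_iso_orbit adm adm') => [phi E]; exists phi; rewrite H2_act_span.
rewrite H2_act_span => E.
apply: jordan_isomorphic_trans (extension_iso_act phi theta').
apply: extension_iso_span; first exact: cocycle_act_lin_indep adm'.1.
move=> i; rewrite E; exists (fun j => (j == i)%:R).
rewrite (bigD1 i) //= eqxx scale1r big1 ?addr0 // => j /negPf ->.
by rewrite scale0r.
Qed.
End Classification.

(** * The bijection between classes and orbits *)

Lemma bijection_of_surjections (T X Y : Type) (p : T -> X) (q : T -> Y) :
    (forall x, exists t, p t = x) -> (forall y, exists t, q t = y) ->
    (forall t t', p t = p t' <-> q t = q t') ->
  exists F : X -> Y, bijective F.
Proof.
move=> /choice[s sK] /choice[s' s'K] pq.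
exists (q \o s); exists (p \o s') => [x|y] /=.
  by rewrite -[RHS]sK; apply/pq; rewrite s'K.
by rewrite -[RHS]s'K; apply/pq; rewrite sK.
Qed.

Theorem theorem29 (K : fieldType) (J : jordanType K) (r : nat)
    (V : vectType K) (hr : (1 <= r)%N) (hV : \dim {:V} = r) :
  exists F : ext_class J V -> U_orbit J r, bijective F.
Proof.
(* Classes and orbits are both images of [T], and [extension_isoP] says that the two maps have the
   same fibres. *)
pose T := {theta : 'I_r -> cocycle J | admissible theta}.
have pP (t : T) : exists2 A, central_ext J V A &
    jordan_isomorphic (extension (sval t)) = jordan_isomorphic A.
  by exists (extension (sval t)) => //; apply: ext_central_ext hV (svalP t).
have qP (t : T) : exists2 W, U r W &
    aut_orbit (lin_span (fun i => coh_class (sval t i))) = aut_orbit W.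
  eexists; last by [].
  by exists (sval t); have [] := svalP t.
apply: (@bijection_of_surjections T _ _ (fun t => exist _ _ (pP t) : ext_class J V)
  (fun t => exist _ _ (qP t) : U_orbit J r)).
- move=> [C CP]; have [A AV CE] := CP.
  have [theta adm iso] := central_ext_extension hV AV.
  exists (exist _ theta adm); apply: eq_exist => /=.
  by rewrite CE; apply/esym/jordan_isomorphic_class.
- move=> [O OP]; have [W [theta [indep WE rad]] OE] := OP.
  exists (exist _ theta (conj indep rad)); apply: eq_exist => /=.
  by rewrite OE WE.
move=> [theta adm] [theta' adm'].
split=> [[/jordan_isomorphic_class/(extension_isoP adm adm') E]|[E]].
  exact: eq_exist.
by apply: eq_exist; apply/jordan_isomorphic_class/(extension_isoP adm adm').
Qed.
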